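(* Let $n\ge 1$ and $r\ge 1$ be integers, and let $g=c(T(n,r))=(c_1(T(n,r)),\ldots,c_r(T(n,r)))\in\mathbb{R}^r$ be the clique vector of the Turán graph $T(n,r)$. Then the convex hull of the set of face vectors of all $r$-colorable simplicial complexes on $n$ vertices is generated by the truncations of $g$, that is, $$\operatorname{conv}\{f(\Delta) : \Delta \text{ an } r\text{-colorable simplicial complex on } n \text{ vertices}\}=\operatorname{conv}\{g^1,g^2,\ldots,g^r\}.$$
   Context: For a (finite) simplicial complex $\Delta$ on $n$ vertices (each of the $n$ vertices is a face of $\Delta$), $\Delta_k$ denotes the set of faces of $\Delta$ of cardinality $k$, and the face vector ($f$-vector) of $\Delta$ is $f(\Delta)=(n,f_2,f_3,\ldots)$ with $f_k=|\Delta_k|$; thus the indexing is by cardinality of faces and the first coordinate is $f_1=n$. The complex $\Delta$ is $r$-colorable if its underlying graph (same vertices as $\Delta$, edge set $\Delta_2$) is $r$-colorable, i.e. admits a proper vertex coloring with $r$ colors. Faces of an $r$-colorable complex have cardinality at most $r$, so its face vector is regarded as a vector $(f_1,\ldots,f_r)\in\mathbb{R}^r$. Graphs are finite, without loops or multiple edges. A $k$-clique of a graph $G$ is a complete induced subgraph of $G$ of order (number of vertices) $k$; $c_k(G)$ is the number of $k$-cliques of $G$, and the clique vector is $c(G)=(c_1(G),c_2(G),\ldots)$. The Turán graph $T(n,r)$ is the complete $r$-partite graph on $n$ vertices whose parts have sizes as equal as possible (any two part sizes differ by at most $1$; if $n<r$ some parts are empty). Its cliques have at most $r$ vertices, so $c(T(n,r))$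 is regarded as a vector in $\mathbb{R}^r$. For a vector $g\in\mathbb{R}^d$ and $1\le k\le d$, the $k$-truncation $g^k$ is the vector in $\mathbb{R}^d$ whose first $k$ coordinates equal those of $g$ and whose remaining coordinates are $0$. *)

(* Defs.v *)
From HB Require Import structures.
From mathcomp Require Import all_boot all_order all_algebra.
From mathcomp Require Import classical_sets reals convex.

Set Implicit Arguments.
Unset Strict Implicit.
Unset Printing Implicit Defensive.

Import GRing.Theory.

Local Open Scope ring_scope.

Section Graphs.
Variable V : finType.
Implicit Types (e : rel V) (A : {set V}) (k r : nat).

Definition clique e A : bool :=
  [forall x in A, forall y in A, (x != y) ==> e x y].

Definition nb_cliques e k : nat :=
  #|[set A : {set V} | clique e A & #|A| == k]%SET|.

(* Entry i (0-based) counts the cliques with i.+1 vertices. *)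
Definition clique_vector (R : realType) r e : 'rV[R]_r :=
  \row_(i < r) (nb_cliques e i.+1)%:R.

Definition colorable r e : Prop :=
  exists c : V -> 'I_r, forall x y, e x y -> c x != c y.

End Graphs.

Section Complexes.
Variable V : finType.
Implicit Types (D : {set {set V}}) (r : nat).

Definition simplicial_complex D : Prop :=
  (forall v : V, [set v]%SET \in D) /\
  (forall s t : {set V}, s \in D -> t \subset s -> t \in D).

Definition underlying_graph D : rel V :=
  [rel x y | (x != y) && ([set x; y]%SET \in D)].

Definition colorable_complex r D : Prop :=
  colorable r (underlying_graph D).

(* Entry i (0-based) counts the faces of cardinality i.+1. *)
Definition face_vector (R : realType) r D : 'rV[R]_r :=
  \row_(i < r) #|[set s in D | #|s| == i.+1]%SET|%:R.

End Complexes.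

(* Complete multipartite graph whose parts are the residue classes modulo r;
   by turan_balanced their sizes differ by at most one. *)
Definition turan (n r : nat) : rel 'I_n :=
  [rel x y : 'I_n | x %% r != y %% r]%N.
Arguments turan : clear implicits.

Lemma turan_balanced n r (i j : 'I_r) :
  (#|[set x : 'I_n | x %% r == i]%N%SET| <=
   #|[set x : 'I_n | x %% r == j]%N%SET|.+1)%N.
Proof.
case: n => [|n].
  by apply: leq_trans (max_card _) _; rewrite card_ord.
set Ci := finset _; set Cj := finset _.
have rgt0 : (0 < r)%N by apply: leq_ltn_trans (ltn_ord i).
pose f (x : 'I_n.+1) : 'I_n.+1 := inord ((x %/ r).-1 * r + j).
pose D := [set x in Ci | (r <= x)%N]%SET.
have divD x : x \in D -> (0 < x %/ r)%N.
  by rewrite !inE divn_gt0 // => /andP[].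
have fD x : x \in D -> f x = ((x %/ r).-1 * r + j)%N :> nat.
  move=> xD; rewrite inordK //; apply: leq_trans (ltn_ord x).
  rewrite ltnS; apply: leq_trans (leq_divM x r).
  by rewrite -[X in (_ <= X * _)%N](prednK (divD _ xD)) mulSnr leq_add2l ltnW.
have cD : (#|D| <= #|Cj|)%N.
  have fI : {in D &, injective f}.
    move=> x y xD yD /(congr1 (@nat_of_ord _)).
    rewrite !fD // => /addIn /eqP; rewrite eqn_pmul2r // => /eqP.
    move=> /(congr1 S); rewrite !prednK ?divD // => q.
    apply: val_inj; rewrite /= (divn_eq x r) (divn_eq y r) q.
    by move: xD yD; rewrite !inE => /andP[/eqP-> _] /andP[/eqP-> _].
  rewrite -(card_in_imset fI); apply: subset_leq_card.
  apply/fintype.subsetP => _ /imsetP[x xD ->].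
  by rewrite inE fD // modnMDl modn_small.
apply: leq_trans (_ : (#|inord (nat_of_ord i) |: D|%SET <= _)%N).
  apply: subset_leq_card; apply/fintype.subsetP => x; rewrite !inE => /eqP xi.
  rewrite xi eqxx /=; case: leqP; rewrite ?orbT // => xr.
  by rewrite orbF -xi modn_small // inord_val.
by rewrite cardsU1; exact: leq_add (leq_b1 _) cD.
Qed.

(* The k-truncation, with 1-based k: coordinates 1, ..., k are kept. *)
Definition truncation (R : realType) d (k : nat) (g : 'rV[R]_d) : 'rV[R]_d :=
  \row_(i < d) if (i < k)%N then g ord0 i else 0.

Definition conv_hull (R : realType) d (X : set 'rV[R]_d) : set 'rV[R]_d :=
  smallest (@convex_set R 'rV[R]_d) X.

(* Main.v *)
Require Import Defs.
From mathcomp Require Import all_boot all_order all_algebra.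
From mathcomp Require Import ring lra zify.
From mathcomp Require Import classical_sets reals convex interval_inference.

Set Implicit Arguments.
Unset Strict Implicit.
Unset Printing Implicit Defensive.

Import Order.TTheory GRing.Theory Num.Theory.

Local Open Scope ring_scope.

(** A truncation of [g] multiplies each coordinate of [g] by 1 or 0, in
    nonincreasing order, so the vectors of the hull on the right are the
    [rho_k * g_k] with [1 = rho_1 >= rho_2 >= ... >= 0].  Two facts are thus
    needed.  First, each truncation is a face vector: [g^k] belongs to the
    skeleton of the clique complex of the Turan graph formed by the cliques with
    at most [k] vertices.  Second, every face vector [f] satisfies
    [f_(k+1) / g_(k+1) <= f_k / g_k], with [f_1 = g_1 = n].

    The second fact is proved in two steps, both stated with the generating
    polynomial of the faces.  Fix a proper coloring and let [m_i] be the number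
    of vertices of color [i].  All faces are rainbow, and the polynomial of the
    family of all rainbow sets is [E = \prod_i (1 + m_i X)].

    - [face_poly_ratio_le] compares [f] with the coefficients of [E], by
      induction on the colors.  Removing a color [i] cuts a complex into the
      faces avoiding [i] and the links of the vertices of color [i], each link
      being a subcomplex of the former.  The inequality for both parts gives it
      for the whole because the coefficients of [E] are log-concave
      ([ratio_le_clawM]).  This is the normalized matching property of a product
      of stars.

    - [ratio_le_balanced] compares [E] with the polynomial of the Turan graph.
      Moving a vertex from a large class to a smaller one keeps the sum of the
      two sizes and does not decrease their product, and log-concavity of the
      polynomial of the remaining classes shows that no ratio of consecutive
      coefficients decreases ([ratio_le_claw2]). *)

(** * Ratios of coefficients of products of linear polynomials *)

Section CoefficientRatios.
Variable R : realFieldType.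
Implicit Types (p q u l : {poly R}) (a b m : R).

(** The condition is stronger than [p_k * p_(k+2) <= p_(k+1) ^ 2]: taking
    [i < j] arbitrary also excludes a zero coefficient between two positive
    ones. *)
Definition log_concave p : Prop :=
  (forall k, 0 <= p`_k) /\
  (forall i j, (i <= j)%N -> p`_i * p`_j.+1 <= p`_i.+1 * p`_j).

(** Where [q_k] and [q_(k+1)] are positive, this says that the ratios [p_k / q_k]
    and [p_(k+1) / q_(k+1)] lie between 0 and 1 and do not increase.  The bound
    [p_k <= q_k] forces [p_k = 0] where [q_k = 0]; this is what makes the
    cross-multiplied relation transitive in the presence of zeros. *)
Definition ratio_le p q : Prop :=
  forall k, 0 <= p`_k <= q`_k /\ p`_k.+1 * q`_k <= p`_k * q`_k.+1.

(** The face polynomial of [m] isolated vertices, the empty face included. *)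
Definition claw m : {poly R} := 1 + m *: 'X.

Lemma coef_clawM0 m p : (claw m * p)`_0 = p`_0.
Proof. by rewrite mulrDl mul1r -scalerAl coefD coefZ coefXM mulr0 addr0. Qed.

Lemma coef_clawMS m p k : (claw m * p)`_k.+1 = p`_k.+1 + m * p`_k.
Proof. by rewrite mulrDl mul1r -scalerAl coefD coefZ coefXM. Qed.

Definition coef_clawM := (coef_clawM0, coef_clawMS).

Lemma log_concave_clawM m p :
  0 <= m -> log_concave p -> log_concave (claw m * p).
Proof.
move=> m0 [p0 lc]; split=> [[|k]|i j].
- by rewrite coef_clawM.
- by rewrite coef_clawM addr_ge0 ?mulr_ge0.
(* The case i = j is split off since the cross term below needs i < j. *)
rewrite leq_eqVlt => /predU1P[->|ij]; first by rewrite mulrC.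
case: i ij => [|i]; case: j => // j ij; rewrite !coef_clawM.
- have h1 := lc 0%N j.+1 isT; have h2 := lc 0%N j isT.
  have := mulr_ge0 m0 (mulr_ge0 m0 (mulr_ge0 (p0 0%N) (p0 j))).
  have := mulr_ge0 m0 (mulr_ge0 (p0 1%N) (p0 j)).
  by nra.
- rewrite ltnS in ij; have h1 := lc i.+1 j.+1 (leqW ij).
  have h2 := ler_wpM2l m0 (ler_wpM2l m0 (lc i j (ltnW ij))).
  have h3 : p`_i * p`_j.+2 <= p`_i.+2 * p`_j.
    apply: le_trans _ (lc i.+1 j ij).
    exact: lc i j.+1 (leqW (ltnW ij)).
  have h4 := ler_wpM2l m0 h3.
  by nra.
Qed.

Lemma log_concave_prod_claw (I : Type) (s : seq I) (m : I -> R) :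
  (forall i, 0 <= m i) -> log_concave (\prod_(i <- s) claw (m i)).
Proof.
move=> m0; elim: s => [|i s IHs].
  2: by rewrite big_cons; apply: log_concave_clawM.
rewrite big_nil; split=> [k|i j _]; rewrite !coef1 ?ler0n //.
by rewrite mulr0 mulr_ge0 ?ler0n.
Qed.

Lemma ratio_le_refl p : (forall k, 0 <= p`_k) -> ratio_le p p.
Proof. by move=> p0 k; rewrite p0 lexx mulrC. Qed.

Lemma ratio_le_trans q p u : ratio_le p q -> ratio_le q u -> ratio_le p u.
Proof.
move=> pq qu k; have [/andP[p0 p_q] pqk] := pq k.
have [/andP[q0 q_u] quk] := qu k.
have [/andP[p0' p_q'] _] := pq k.+1; have [/andP[q0' q_u'] _] := qu k.+1.
split; first by rewrite p0 (le_trans p_q).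
have [qk0|qk_neq0] := eqVneq (q`_k) 0.
  have pk0 : p`_k = 0 by apply/le_anti; rewrite p0 -[X in _ <= X]qk0 p_q.
  rewrite pk0 mul0r; apply: le_trans (ler_wpM2r _ p_q') _.
    exact: le_trans q_u.
  by rewrite (le_trans quk) // qk0 mul0r.
have qk_gt0 : 0 < q`_k by rewrite lt_neqAle eq_sym qk_neq0.
rewrite -(ler_pM2r qk_gt0).
have h1 := ler_wpM2r (le_trans q0 q_u) pqk.
have h2 := ler_wpM2l p0 quk.
by nra.
Qed.

Lemma ratio_le_sum (I : finType) (P : pred I) (f : I -> {poly R}) q u :
    (forall i, P i -> ratio_le (f i) q) ->
    (forall i k, P i -> (f i)`_k <= u`_k) ->
  forall k, [/\ 0 <= (\sum_(i | P i) f i)`_k,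
    (\sum_(i | P i) f i)`_k <= #|P|%:R * u`_k
    & (\sum_(i | P i) f i)`_k.+1 * q`_k <= (\sum_(i | P i) f i)`_k * q`_k.+1].
Proof.
move=> fq fu k; rewrite !coef_sum !mulr_suml; split.
- by apply: sumr_ge0 => i /fq /(_ k)[/andP[]].
- rewrite mulr_natl -sumr_const; apply: ler_sum => i Pi; exact: fu.
- by apply: ler_sum => i /fq /(_ k)[].
Qed.

(** The inductive step on the colors: [p] counts the faces avoiding a color
    class of size [m], and [l] is the sum of the polynomials of the links of its
    vertices; these links are subfamilies of what [p] counts, whence
    [l_k <= m * p_k].  After cancelling the inequalities assumed on [p] and [l]
    and multiplying by [q_k], what remains is the product of [m * p_k - l_k] and
    [q_k ^ 2 - q_(k-1) * q_(k+1)], both nonnegative. *)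
Lemma ratio_le_clawM m p q l : log_concave q -> 0 <= m -> ratio_le p q ->
    (forall k, [/\ 0 <= l`_k, l`_k <= m * p`_k
                 & l`_k.+1 * q`_k <= l`_k * q`_k.+1]) ->
  ratio_le (p + 'X * l) (claw m * q).
Proof.
move=> [q0 lc] m0 pq hl.
have lmq k : l`_k <= m * q`_k.
  have [_ /le_trans-> //] := hl k.
  by rewrite ler_wpM2l //; have [/andP[]] := pq k.
case=> [|k]; rewrite !coefD !coefXM /= !coef_clawM.
  have [/andP[p0 p_q] h] := pq 0%N; have [l0 lm _] := hl 0%N.
  rewrite addr0 p0 p_q; split=> //.
  have := ler_wpM2r (q0 0%N) lm; by nra.
have [/andP[p0 p_q] h] := pq k.+1; have [l0 lm hlk] := hl k.
have [l1 lm1 _] := hl k.+1; have [/andP[p2 p_q2] _] := pq k.+2.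
split; first by rewrite addr_ge0 //= lerD.
(* What is left of the goal once [h], and [hlk] multiplied by [m], are
   subtracted. *)
suff : m * (p`_k.+2 * q`_k) + l`_k.+1 * q`_k.+1 <=
       m * (p`_k.+1 * q`_k.+1) + l`_k * q`_k.+2.
  have := ler_wpM2l m0 hlk; by nra.
have lck := lc k k.+1 (leqnSn k).
have [E0|E0] := eqVneq (q`_k.+1) 0.
  rewrite E0 !mulr0 addr0 add0r.
  have : p`_k.+2 * q`_k <= 0.
    apply: le_trans (ler_wpM2r (q0 k) p_q2) _.
    by rewrite mulrC (le_trans lck) // E0 mulr0.
  move=> /(ler_wpM2l m0); rewrite mulr0 => /le_trans; apply.
  exact: mulr_ge0.
have Egt0 : 0 < q`_k.+1 by rewrite lt_neqAle eq_sym E0 q0.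
rewrite -(ler_pM2r Egt0).
have h1 := ler_wpM2l m0 (ler_wpM2r (q0 k) h).
have h2 := ler_wpM2r (q0 k.+2) hlk.
(* The defect of the inequality multiplied by [q_(k+1)]. *)
have h3 : 0 <= (m * p`_k.+1 - l`_k.+1) *
               (q`_k.+1 * q`_k.+1 - q`_k * q`_k.+2).
  by rewrite mulr_ge0 // subr_ge0.
by nra.
Qed.

(** Both products have the form [q + y u], with [q = (1 + (a + b) X) p] and
    [u = X ^ 2 p] independent of how the sum [a + b] is divided, and with [y]
    the product of the two sizes.  Increasing [y] does not decrease the ratios as
    soon as [q_(k+1) * u_k <= q_k * u_(k+1)], which is log-concavity of [p]. *)
Lemma ratio_le_claw2 a b a' b' p : log_concave p ->
    0 <= a -> 0 <= b -> a + b = a' + b' -> a * b <= a' * b' ->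
  ratio_le (claw a * (claw b * p)) (claw a' * (claw b' * p)).
Proof.
move=> [p0 lc] a0 b0 s_eq ab.
have E x y : claw x * (claw y * p) =
    claw (x + y) * p + (x * y) *: ('X * ('X * p)).
  rewrite /claw -!mul_polyC polyCD polyCM; ring.
rewrite !{}E -s_eq.
set q := claw (a + b) * p; set u := 'X * ('X * p).
have s0 : 0 <= a + b by exact: addr_ge0.
have ab0 : 0 <= a * b by exact: mulr_ge0.
have q0 k : 0 <= q`_k.
  case: k => [|k]; rewrite coef_clawM //.
  by apply: addr_ge0 => //; apply: mulr_ge0.
have u0 k : 0 <= u`_k by case: k => [|[|k]]; rewrite !coefXM /=.
have qu k : q`_k.+1 * u`_k <= q`_k * u`_k.+1.
  case: k => [|[|k]]; rewrite !coefXM /= ?mulr0 //; first exact: mulr_ge0.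
  rewrite !coef_clawM.
  have h1 := lc k k.+2 (leqW (leqnSn k)).
  have h2 := ler_wpM2l s0 (lc k k.+1 (leqnSn k)).
  by nra.
move=> k; rewrite !coefD !coefZ; split.
  by rewrite addr_ge0 ?mulr_ge0 //= lerD2l ler_wpM2r.
have := ler_wpM2l (_ : 0 <= a' * b' - a * b) (qu k).
rewrite subr_ge0 => /(_ ab); by nra.
Qed.

(** If [m] differs from [t], some [m i] exceeds [t i] and some [m j] is less
    than [t j].  As [t] is balanced, [m j < m i], so that moving one unit from
    [i] to [j] does not decrease the product [m i * m j], and it brings [m]
    closer to [t].  Aiming at [t] directly avoids showing that all balanced
    vectors with a given sum are permutations of one another. *)
Lemma ratio_le_balanced (I : finType) (t m : I -> nat) :
    (forall i j, (t i <= (t j).+1)%N) -> (\sum_i m i = \sum_i t i)%N ->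
  ratio_le (\prod_i claw (m i)%:R) (\prod_i claw (t i)%:R).
Proof.
move=> t_bal.
have [d] := ubnP (\sum_i (m i - t i))%N; elim: d m => // d IHd m.
rewrite ltnS => md sum_mt.
have [/existsP[i ti_lt]|/existsPn m_le] := boolP [exists i, (t i < m i)%N];
  last first.
  have mt i : m i = t i.
    apply/eqP; have le_mt j : (m j <= t j)%N by rewrite leqNgt.
    have /leqif_sum := fun i (_ : true) => leqif_eq (le_mt i).
    by case=> _; rewrite sum_mt eqxx => /esym/forall_inP/(_ i isT).
  under eq_bigr do rewrite mt.
  by apply: ratio_le_refl => k; case: (log_concave_prod_claw (index_enum I)
    (fun i => ler0n R (t i))).
have [j tj_gt] : exists j, (m j < t j)%N.
  apply/existsP; apply: contraT => /existsPn t_le.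
  suff : (\sum_i t i < \sum_i m i)%N by rewrite sum_mt ltnn.
  rewrite (bigD1 i) //= [X in (_ < X)%N](bigD1 i) //= -addSn leq_add //.
  by apply: leq_sum => j _; rewrite leqNgt.
have ij : i != j by apply: contraTneq ti_lt => ->; rewrite -leqNgt ltnW.
have mij : (m j < m i)%N.
  by apply: leq_trans ti_lt; apply: leq_trans tj_gt _.
pose m' x := if x == i then (m i).-1 else if x == j then (m j).+1 else m x.
have m'i : m' i = (m i).-1 by rewrite /m' eqxx.
have m'j : m' j = (m j).+1 by rewrite /m' eq_sym (negPf ij) eqxx.
have m'_out x : (x != i) && (x != j) -> m' x = m x.
  by rewrite /m' => /andP[/negPf-> /negPf->].
have ji : j != i by rewrite eq_sym.
have split2 T (idx : T) (op : Monoid.com_law idx) (F : I -> T) :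
    \big[op/idx]_x F x =
    op (F i) (op (F j) (\big[op/idx]_(x | (x != i) && (x != j)) F x)).
  by rewrite (bigD1 i) //= (bigD1 j).
apply: (@ratio_le_trans (\prod_x claw (m' x)%:R)); last first.
  apply: IHd.
    apply: leq_trans md; rewrite !split2 /= m'i m'j.
    by rewrite (eq_bigr (fun x => m x - t x)%N) => [|x /m'_out-> //]; lia.
  by rewrite -sum_mt !split2 /= m'i m'j (eq_bigr m) => [|x /m'_out//]; lia.
rewrite !split2 /= m'i m'j.
rewrite [X in ratio_le _ (_ * (_ * X))](eq_bigr (fun x => claw (m x)%:R));
  last by move=> x /m'_out->.
apply: ratio_le_claw2; rewrite ?ler0n //.
- by rewrite -big_filter; apply: log_concave_prod_claw => x; rewrite ler0n.
- by rewrite -!natrD; congr _%:R; lia.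
- by rewrite -!natrM ler_nat; nia.
Qed.

End CoefficientRatios.

(** * Face polynomials of families of rainbow sets *)

Section RainbowFamilies.
Variables (R : realFieldType) (V : finType) (C : eqType) (c : V -> C).
Implicit Types (D : {set {set V}}) (A B : {set V}) (s : seq C) (i : C).

Definition face_poly D : {poly R} := \sum_(A in D) 'X^#|A|.

Lemma coef_face_poly D k :
  (face_poly D)`_k = #|[set A in D | #|A| == k]%SET|%:R.
Proof.
rewrite coef_sum (eq_bigr (fun A => if #|A| == k then 1 else 0)).
  rewrite -big_mkcondr /= sumr_const; congr _%:R.
  by apply: eq_card => A; rewrite !inE.
by move=> A _; rewrite coefXn eq_sym; case: eqP.
Qed.

Lemma face_poly_ge0 D k : 0 <= (face_poly D)`_k.
Proof. by rewrite coef_face_poly ler0n. Qed.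

Lemma face_polyS D D' k :
  D \subset D' -> (face_poly D)`_k <= (face_poly D')`_k.
Proof.
move=> /fintype.subsetP DD'; rewrite !coef_face_poly ler_nat subset_leq_card //.
by apply/fintype.subsetP => A; rewrite !inE => /andP[/DD'-> ->].
Qed.

Definition color_deletion D i : {set {set V}} :=
  [set A in D | [forall v in A, c v != i]]%SET.

Definition link D v : {set {set V}} :=
  [set A : {set V} | (v \notin A) && (v |: A \in D)]%SET.

Definition down_closed D : Prop :=
  forall A B, A \in D -> B \subset A -> B \in D.

Definition rainbow s : {set {set V}} :=
  [set A : {set V} | dinjectiveb c A & [forall v in A, c v \in s]]%SET.

Lemma rainbowP s A :
  reflect ({in A &, injective c} /\ {in A, forall v, c v \in s})
          (A \in rainbow s).
Proof.
rewrite inE; apply: (iffP andP) => -[].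
  by move=> /dinjectiveP cA /forall_inP As.
by move=> cA As; split; [apply/dinjectiveP | apply/forall_inP].
Qed.

Lemma face_poly_link D v :
  \sum_(A in D | v \in A) 'X^#|A| = 'X * face_poly (link D v).
Proof.
rewrite mulr_sumr (reindex_onto (fun B => v |: B) (fun A => A :\ v)).
  rewrite (eq_bigl [pred B | B \in link D v]) /=.
    by apply: eq_bigr => B; rewrite inE => /andP[vB _]; rewrite cardsU1 vB exprS.
  move=> B; rewrite setU11 andbT andbC [RHS]inE; congr (_ && _).
  have [vB|vB] := boolP (v \in B); last by rewrite setU1K // eqxx.
  by apply/eqP => /finset.setP/(_ v); rewrite vB !inE eqxx.
by move=> A /andP[_ vA]; rewrite finset.setD1K.
Qed.

(** A rainbow set that meets the class of [i] does so in exactly one vertex, so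
    it is counted in the link of exactly one vertex of that class. *)
Lemma face_poly_color D s i : D \subset rainbow s ->
  face_poly D =
  face_poly (color_deletion D i) + 'X * \sum_(v | c v == i) face_poly (link D v).
Proof.
move=> /fintype.subsetP Ds; rewrite mulr_sumr.
under [X in _ + X]eq_bigr do rewrite -face_poly_link.
rewrite (exchange_big_dep (mem D)) /=; last by move=> v A _ /andP[].
have -> : face_poly (color_deletion D i) =
    \sum_(A in D | [forall v in A, c v != i]) 'X^#|A|.
  by apply: eq_bigl => A; rewrite inE.
rewrite big_mkcondr -big_split /=; apply: eq_bigr => A AD.
have /rainbowP[cA _] := Ds A AD.
case: forall_inP => [no_i|].
  rewrite big1 ?addr0 // => v /andP[ci /andP[_ /no_i]].
  by rewrite ci.
move=> /forall_inP; rewrite negb_forall_in => /exists_inP[v vA].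
rewrite negbK => /eqP ci; rewrite add0r (big_pred1 v) // => w /=.
rewrite AD /=; apply/andP/eqP => [[/eqP cw wA]|->]; last by rewrite ci.
by apply: cA => //; rewrite cw ci.
Qed.

Definition class_size i : nat := #|[set v | c v == i]%SET|.

(** The links of the vertices of color [i] are contained in the family of the
    faces avoiding [i]: this gives both the induction hypothesis for them and
    the bound on their sum in terms of the size of the class. *)
Lemma face_poly_ratio_le s D : down_closed D -> D \subset rainbow s ->
  ratio_le (face_poly D) (\prod_(i <- s) claw (class_size i)%:R).
Proof.
elim: s D => [|i s IHs] D Ddown Ds; have /fintype.subsetP Ds' := Ds.
  have D0 A : A \in D -> A = finset.set0.
    move=> /Ds'/rainbowP[_ A0]; apply/eqP; apply: contraT => /set0Pn[v /A0].
    by rewrite in_nil.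
  rewrite big_nil => k; rewrite !coef1 mulr0 face_poly_ge0 /=.
  have faceS j : (face_poly D)`_j.+1 = 0.
    rewrite coef_face_poly eq_card0 // => A; rewrite !inE.
    by apply: contraTF isT => /andP[/D0->]; rewrite cards0.
  rewrite faceS mul0r; split=> //; case: k => [|k]; last by rewrite faceS.
  rewrite coef_face_poly ler_nat -[nat_of_bool _]/1%N.
  rewrite -(cards1 (finset.set0 : {set V})).
  by apply/subset_leq_card/fintype.subsetP => A; rewrite !inE => /andP[/D0->].
rewrite big_cons (face_poly_color i Ds).
have m0 j : 0 <= (class_size j)%:R :> R by rewrite ler0n.
have del_s : ratio_le (face_poly (color_deletion D i))
                      (\prod_(j <- s) claw (class_size j)%:R).
  apply: IHs => [A B|]; rewrite ?inE.
    move=> /andP[AD /forall_inP Ai] BA; rewrite (Ddown A) //=.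
    by apply/forall_inP => v /(fintype.subsetP BA)/Ai.
  apply/fintype.subsetP => A; rewrite inE => /andP[/Ds'/rainbowP[cA As]].
  move=> /forall_inP Ai; apply/rainbowP; split=> // v vA.
  by have := As v vA; rewrite inE (negPf (Ai v vA)).
have link_down v : down_closed (link D v).
  move=> A B; rewrite !inE => /andP[vA AD] BA; apply/andP; split.
    by apply: contra vA; apply: (fintype.subsetP BA).
  exact: Ddown AD (finset.setUS _ BA).
have link_del v : c v == i -> link D v \subset color_deletion D i.
  move=> /eqP ci; apply/fintype.subsetP => A; rewrite !inE => /andP[vA AD].
  rewrite (Ddown _ _ AD (finset.subsetUr _ _)) /=; apply/forall_inP => w wA.
  have /rainbowP[cA _] := Ds' _ AD; apply: contra vA => /eqP cw.
  by rewrite (cA v w) ?inE ?eqxx ?wA ?orbT // ci cw.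
have link_s v : c v == i ->
    ratio_le (face_poly (link D v)) (\prod_(j <- s) claw (class_size j)%:R).
  move=> ci; apply: IHs => //; apply: fintype.subset_trans (link_del v ci) _.
  apply/fintype.subsetP => A; rewrite inE => /andP[/Ds'/rainbowP[cA As]].
  move=> /forall_inP Ai; apply/rainbowP; split=> // w wA.
  by have := As w wA; rewrite inE (negPf (Ai w wA)).
have link_le v k : c v == i ->
    (face_poly (link D v))`_k <= (face_poly (color_deletion D i))`_k.
  by move=> /link_del; apply: face_polyS.
apply: ratio_le_clawM => // [|k]; first exact: log_concave_prod_claw.
have [h1 h2 h3] := ratio_le_sum link_s link_le k.
by split=> //; rewrite /class_size cardsE.
Qed.

(** For the family of all rainbow sets, the link of every vertex of color [i]
    is the whole family of the rainbow sets avoiding [i]. *)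
Lemma face_poly_rainbow s : uniq s ->
  face_poly (rainbow s) = \prod_(i <- s) claw (class_size i)%:R.
Proof.
elim: s => [_|i s IHs /= /andP[is_ us]].
  rewrite big_nil /face_poly (big_pred1 finset.set0) ?cards0 // => A /=.
  apply/rainbowP/eqP => [[_ A0]|->]; last by split=> v; rewrite inE.
  by apply/eqP; apply: contraT => /set0Pn[v /A0]; rewrite in_nil.
rewrite big_cons -IHs // (@face_poly_color _ (i :: s) i) //.
have -> : color_deletion (rainbow (i :: s)) i = rainbow s.
  apply/finset.setP => A; rewrite [LHS]inE.
  apply/andP/rainbowP => [[/rainbowP[cA As] /forall_inP Ai]|[cA As]].
    split=> // v vA; have := As v vA; by rewrite inE (negPf (Ai v vA)).
  split; first by apply/rainbowP; split=> // v /As; rewrite inE orbC => ->.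
  by apply/forall_inP => v /As; apply: contraTneq => ->.
rewrite mulrDl mul1r -scalerAl (eq_bigr (fun=> face_poly (rainbow s))).
  by rewrite sumr_const mulrnAr /class_size cardsE scaler_nat.
move=> v /eqP ci; congr face_poly; apply/finset.setP => A; rewrite [LHS]inE.
apply/andP/rainbowP => [[vA /rainbowP[cA As]]|[cA As]].
  split=> [x y xA yA|w wA]; first by apply: cA; rewrite !inE ?xA ?yA orbT.
  have := As w; rewrite !inE wA orbT => /(_ isT)/predU1P[cw|//].
  by case/negP: vA; rewrite (cA v w) ?inE ?eqxx ?wA ?orbT // ci cw.
have vA : v \notin A by apply: contra is_ => /As; rewrite ci.
split=> //; apply/rainbowP; split=> [x y|w].
  have cv_neq x0 : x0 \in A -> c v != c x0.
    by move=> /As; apply: contraTneq => <-; rewrite ci.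
  rewrite !inE => /predU1P[->|xA] /predU1P[->|yA] // cxy; last exact: cA.
    by have := cv_neq y yA; rewrite cxy eqxx.
  by have := cv_neq x xA; rewrite cxy eqxx.
by rewrite !inE => /predU1P[->|/As->]; rewrite ?ci ?eqxx ?orbT.
Qed.

End RainbowFamilies.

(** * Convex hull of the truncations of a vector *)

Section ConvexHull.
Variable R : realType.

Lemma convex_conv_hull d (X : set 'rV[R]_d) : convex_set (conv_hull X).
Proof.
move=> x y t; rewrite !inE => Xx Xy A [cA XA].
have := cA x y t; rewrite !inE; apply; [exact: Xx|exact: Xy].
Qed.

Lemma convex_setP d (X : set 'rV[R]_d) (t : R) x y :
  convex_set X -> 0 <= t <= 1 -> X x -> X y -> X (t *: x + (1 - t) *: y).
Proof.
move=> cX /andP[t0 t1] Xx Xy.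
have := cX x y (Itv01 t0 t1); rewrite !inE; exact.
Qed.

(** Scaling the coordinates of [g] by a nonincreasing sequence of nonnegative
    factors starting at 1 yields a convex combination of its truncations.  The
    proof replaces, from the last coordinate down, the factors by
    [1, ..., 1, rho_(j+1) / rho_j, rho_(j+2) / rho_j, ...]; the vector for [j]
    lies between the one for [j + 1] and the truncation that keeps coordinates
    [0, ..., j]. *)
Lemma convex_set_truncations d (X : set 'rV[R]_d) (g : 'rV[R]_d)
    (rho : nat -> R) :
    convex_set X -> (forall k, (1 <= k <= d)%N -> X (truncation k g)) ->
    (0 < d)%N -> rho 0%N = 1 -> (forall i, 0 <= rho i.+1 <= rho i) ->
  X (\row_i (rho i * g ord0 i)).
Proof.
move=> cX gX d_gt0 rho0 rhoS.
have rho_ge0 i : 0 <= rho i.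
  by case: i => [|i]; [rewrite rho0 | have /andP[] := rhoS i].
have rho_le i j : (i <= j)%N -> rho j <= rho i.
  move=> /subnK<-; elim: (j - i)%N => // e; apply: le_trans.
  by have /andP[] := rhoS (e + i)%N.
suff tail e j : (j.+1 + e = d)%N ->
    X (\row_(i < d) ((if (i <= j)%N then 1 else rho i / rho j) * g ord0 i)).
  have := tail d.-1 0%N; rewrite add1n prednK // => /(_ erefl).
  rewrite (_ : (\row__ _) = \row_i (rho i * g ord0 i)) //.
  apply/rowP => i; rewrite !mxE rho0 divr1.
  by case: (nat_of_ord i) => // ; rewrite rho0.
elim: e j => [|e IHe] j jd.
  rewrite (_ : (\row__ _) = truncation j.+1 g); first by apply: gX; lia.
  by apply/rowP => i; rewrite !mxE; have := ltn_ord i;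
    rewrite -[X in (_ < X)%N]jd addn0 ltnS => ->; rewrite mul1r.
(* If [rho j = 0] then [t = 0], which is the right weight since all later
   factors vanish too. *)
pose t := rho j.+1 / rho j.
have t01 : 0 <= t <= 1.
  rewrite /t divr_ge0 //=; have [->|rj] := eqVneq (rho j) 0.
    by rewrite invr0 mulr0.
  by rewrite ler_pdivrMr ?mul1r ?rho_le // lt_neqAle eq_sym rj rho_ge0.
have Xe := IHe j.+1; rewrite addSnnS jd in Xe; have {}Xe := Xe erefl.
have Xg : X (truncation j.+1 g) by apply: gX; lia.
have := convex_setP cX t01 Xe Xg.
rewrite (_ : _ + _ = \row_(i < d)
  ((if (i <= j)%N then 1 else rho i / rho j) * g ord0 i)) //.
apply/rowP => i; rewrite !mxE ltnS.
case: (ltngtP i j.+1) => [ij|ij|->].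
- rewrite (_ : (i <= j)%N = true) //; ring.
- rewrite (_ : (i <= j)%N = false) ?mulr0 ?addr0; last by lia.
  rewrite mulrA; congr (_ * _); rewrite /t.
  have [r0|r0] := eqVneq (rho j.+1) 0.
    have -> : rho i = 0 by apply/le_anti; rewrite rho_ge0 -r0 rho_le // ltnW.
    by rewrite !mul0r mulr0.
  by rewrite mulrC mulrA divfK.
- rewrite ltnn mul1r mulr0 addr0 //.
Qed.

End ConvexHull.

(** * Cliques of the Turan graph *)

Section TuranGraph.
Variables (R : realType) (n r : nat).
Hypothesis r_gt0 : (0 < r)%N.

Let residue (x : 'I_n) : 'I_r := Ordinal (ltn_pmod x r_gt0).

Definition turan_poly : {poly R} :=
  face_poly R [set A | clique (turan n r) A]%SET.

Lemma clique_turan : [set A | clique (turan n r) A]%SET =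
  rainbow residue (index_enum 'I_r).
Proof.
apply/finset.setP => A; rewrite inE; apply/forall_inP/rainbowP.
  move=> clA; split=> [x y xA yA /(congr1 val)/= xy|x _]; last first.
    exact: mem_index_enum.
  apply/eqP; apply: contraT => x_neq_y.
  by have /forall_inP/(_ y yA) := clA x xA; rewrite x_neq_y /turan /= xy eqxx.
move=> [cA _] x xA; apply/forall_inP => y yA; apply/implyP.
by apply: contra => /eqP xy; apply/eqP/cA => //; apply/val_inj.
Qed.

Lemma turan_log_concave : log_concave turan_poly.
Proof.
rewrite /turan_poly clique_turan face_poly_rainbow ?index_enum_uniq //.
by apply: log_concave_prod_claw => i; rewrite ler0n.
Qed.

Lemma coef0_turan_poly : 0 < turan_poly`_0.
Proof.
rewrite coef_face_poly ltr0n card_gt0; apply/set0Pn; exists finset.set0.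
by rewrite !inE cards0 eqxx andbT; apply/forall_inP => x; rewrite inE.
Qed.

Lemma sum_class_size (V I : finType) (c : V -> I) :
  (\sum_i class_size c i)%N = #|V|.
Proof.
rewrite -sum1_card (partition_big c xpredT) //=; apply: eq_bigr => i _.
by rewrite /class_size cardsE -sum1_card.
Qed.

(** Any proper coloring of the complex will do: its class sizes add up to [n],
    and the sizes of the residue classes modulo [r], which give the Turan graph,
    are the balanced ones with that sum. *)
Lemma colorable_ratio_le (V : finType) (D : {set {set V}}) : #|V| = n ->
  simplicial_complex D -> colorable_complex r D ->
  ratio_le (face_poly R D) turan_poly.
Proof.
move=> Vn [_ Ddown] [c c_proper].
have D_rainbow : D \subset rainbow c (index_enum 'I_r).
  apply/fintype.subsetP => A AD; apply/rainbowP.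
  split=> [x y xA yA cxy|x _]; last exact: mem_index_enum.
  apply/eqP; apply: contraT => x_neq_y.
  have := c_proper x y; rewrite cxy eqxx; apply.
  rewrite /underlying_graph /= x_neq_y; apply: Ddown AD _.
  by apply/fintype.subsetP => z; rewrite !inE => /pred2P[]->.
apply: ratio_le_trans (face_poly_ratio_le R Ddown D_rainbow) _.
rewrite /turan_poly clique_turan face_poly_rainbow ?index_enum_uniq //.
apply: ratio_le_balanced => [i j|]; last by rewrite !sum_class_size card_ord.
exact: (turan_balanced n i j).
Qed.

End TuranGraph.

Lemma card_singletons (V : finType) (D : {set {set V}}) :
  (forall v, [set v]%SET \in D) -> #|[set A in D | #|A| == 1%N]%SET| = #|V|.
Proof.
move=> D1; rewrite -cardsT -(card_imset _ (@set1_inj V)).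
apply: eq_card => A; rewrite inE; apply/andP/imsetP => [[_ /cards1P[v ->]]|].
  by exists v.
by move=> [v _ ->]; rewrite cards1 D1.
Qed.

(** The complex whose face vector is the [k]-truncation of the clique vector. *)
Definition turan_skeleton n r k : {set {set 'I_n}} :=
  [set A : {set 'I_n} | clique (turan n r) A & (#|A| <= k)%N]%SET.

Lemma turan_skeleton_complex n r k :
  (0 < k)%N -> simplicial_complex (turan_skeleton n r k).
Proof.
move=> k_gt0; split=> [v|A B].
  rewrite inE cards1 k_gt0 andbT; apply/forall_inP => x; rewrite inE => /eqP->.
  by apply/forall_inP => y; rewrite inE => /eqP->; rewrite eqxx.
rewrite !inE => /andP[/forall_inP clA kA] BA; apply/andP; split.
  apply/forall_inP => x /(fintype.subsetP BA)/clA/forall_inP xA.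
  by apply/forall_inP => y /(fintype.subsetP BA)/xA.
exact: leq_trans (subset_leq_card BA) kA.
Qed.

Lemma turan_skeleton_colorable n r k :
  (0 < r)%N -> colorable_complex r (turan_skeleton n r k).
Proof.
move=> r_gt0; exists (fun x : 'I_n => Ordinal (ltn_pmod x r_gt0)) => x y.
rewrite /underlying_graph /= inE => /andP[x_neq_y /andP[/forall_inP/(_ x)]].
rewrite !inE eqxx => /(_ isT)/forall_inP/(_ y).
by rewrite !inE eqxx orbT x_neq_y => /(_ isT).
Qed.

Lemma face_vector_turan_skeleton (R : realType) n r k :
  face_vector R r (turan_skeleton n r k) =
  truncation k (clique_vector R r (turan n r)).
Proof.
apply/rowP => i; rewrite !mxE /nb_cliques; case: ltnP => ik.
  congr _%:R; apply: eq_card => A; rewrite !inE -andbA; congr (_ && _).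
  by case: eqP => [->|_]; rewrite ?ik ?andbF.
rewrite eq_card0 // => A; rewrite !inE -andbA.
by apply: contraTF ik => /and3P[_ Ak /eqP Ai]; rewrite -ltnNge -Ai.
Qed.

Theorem theorem1p1 (R : realType) (n r : nat) (hn : (1 <= n)%N)
    (hr : (1 <= r)%N) :
  let g : 'rV[R]_r := clique_vector R r (turan n r) in
  conv_hull
    [set f : 'rV[R]_r | exists (V : finType) (D : {set {set V}}),
       [/\ #|V| = n, simplicial_complex D, colorable_complex r D
         & f = face_vector R r D]]%classic
  = conv_hull
    [set truncation k g | k in [set k : nat | (1 <= k <= r)%N]]%classic.
Proof.
move=> g; apply/seteqP; split; apply: smallest_sub;
  try exact: convex_conv_hull.
  move=> _ [V [D [Vn Dcx Dcol ->]]].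
  pose F := face_poly R D; pose G := turan_poly R n r.
  have FG : ratio_le F G by exact: colorable_ratio_le.
  have G0 k : 0 <= G`_k by exact: face_poly_ge0.
  (* The support of G is an initial segment, as G`_0 > 0 and G is log-concave. *)
  have G_gt0 k : 0 < G`_k.+1 -> 0 < G`_k.
    move=> Gk; rewrite lt_neqAle eq_sym G0 andbT; apply: contraTneq Gk => Gk0.
    have [_ /(_ 0%N k isT)] := turan_log_concave R n hr.
    by rewrite -/G Gk0 mulr0 pmulr_rle0 ?coef0_turan_poly // leNgt.
  have gE (i : 'I_r) : g ord0 i = G`_i.+1.
    rewrite mxE coef_face_poly /nb_cliques; congr _%:R.
    by apply: eq_card => A; rewrite !inE.
  have -> : face_vector R r D = \row_i (F`_i.+1 / G`_i.+1 * g ord0 i).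
    apply/rowP => i; rewrite [RHS]mxE gE [LHS]mxE -coef_face_poly -/F.
    have [/andP[Fi FGi] _] := FG i.+1.
    have [Gi|Gi] := eqVneq (G`_i.+1) 0; last by rewrite divfK.
    by rewrite Gi mulr0; apply/le_anti; rewrite Fi -[X in _ <= X]Gi FGi.
  apply: (@convex_set_truncations R r _ g (fun i => F`_i.+1 / G`_i.+1)) => //.
  - exact: convex_conv_hull.
  - by move=> k hk; apply: sub_gen_smallest; exists k.
  - have [D1 _] := Dcx; rewrite !coef_face_poly !card_singletons // => [|v].
      by rewrite Vn card_ord divff // pnatr_eq0 -lt0n.
    have [/(_ v)] := @turan_skeleton_complex n r 1 isT.
    by rewrite !inE => /andP[].
  move=> i; have [/andP[Fi1 _] FGi] := FG i.+1; have [/andP[Fi2 _] _] := FG i.+2.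
  rewrite divr_ge0 //=.
  have [Gi2|Gi2] := eqVneq (G`_i.+2) 0.
    by rewrite Gi2 invr0 mulr0 divr_ge0.
  have Gi2_gt0 : 0 < G`_i.+2 by rewrite lt_neqAle eq_sym Gi2 G0.
  have Gi1_gt0 := G_gt0 _ Gi2_gt0.
  by rewrite ler_pdivrMr // mulrAC ler_pdivlMr.
move=> _ [k /andP[k_gt0 _] <-]; apply: sub_gen_smallest.
exists 'I_n, (turan_skeleton n r k); split.
- exact: card_ord.
- exact: turan_skeleton_complex.
- exact: turan_skeleton_colorable.
- by rewrite face_vector_turan_skeleton.
Qed.
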